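(* Let $L_{S_3}$ be the set of all Schröder paths of order $n\ge 1$, and let $R_{L_{S_3}}(x,y,z)=1+\sum_{P\in L_{S_3}}x^{\mathrm{order}(P)}y^{\mathrm{dr}(P)}z^{\mathrm{hr}(P)}$. Then $$R_{L_{S_3}}(x,y,z)=\frac{1-xz+x}{1-xz}\cdot\frac{1+(1-w)u-\sqrt{1-2(1+w)u+(1-w)^2u^2}}{2u},$$ where $$u=x\left(\frac{x+y(1-xz)}{1-xz}\right)^2\quad\text{and}\quad w=\left(\frac{1-xz+x}{x+y(1-xz)}\right)^2.$$
   Context: Let $S_3=\{(1,1),(1,-1),(2,0)\}$; the steps $U=(1,1)$, $D=(1,-1)$, $H=(2,0)$ are called up, down and horizontal steps. For $n\ge 1$, $L_{S_3}(n)$ is the set of lattice paths from $(0,0)$ to $(2n,0)$ with steps in $S_3$ that never go below the $x$-axis (Schröder paths of order $n$), and $L_{S_3}=\bigcup_{n\ge 1}L_{S_3}(n)$. For a path $P\in L_{S_3}(n)$, $\mathrm{order}(P)=n$. A run of $P$ is a vertex between two consecutive steps of the same kind; it is diagonal if it joins two consecutive up steps or two consecutive down steps, and horizontal if it joins two consecutive horizontal steps. $\mathrm{dr}(P)$ and $\mathrm{hr}(P)$ denote the numbers of diagonal runs and of horizontal runs of $P$. Identities are between formal power series in $x$ (with coefficients in $\mathbb{Q}(y,z)$), and the square root is the one with constant term $1$ in $x$. *)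

(* Defs.v *)
From HB Require Import structures.
From mathcomp Require Import all_boot all_order all_algebra.
From mathcomp Require boolp.

Set Implicit Arguments.
Unset Strict Implicit.
Unset Printing Implicit Defensive.

Import Order.TTheory GRing.Theory Num.Theory.
Local Open Scope ring_scope.

Record fps (K : fieldType) := Fps { coefs : nat -> K }.

Section FpsRing.
Variable K : fieldType.
Implicit Types f g h : fps K.

Lemma fpsP f g : (forall n, coefs f n = coefs g n) <-> f = g.
Proof.
split=> [|->//]; case: f; case: g => g f /= e.
by congr Fps; apply: boolp.funext.
Qed.

HB.instance Definition _ := boolp.gen_eqMixin (fps K).
HB.instance Definition _ := boolp.gen_choiceMixin (fps K).

Definition fpsC (c : K) : fps K := Fps (fun n => if n == 0%N then c else 0).
Definition fpsX : fps K := Fps (fun n => (n == 1%N)%:R).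

Definition add_fps f g := Fps (fun n => coefs f n + coefs g n).
Definition opp_fps f := Fps (fun n => - coefs f n).
Definition mul_fps f g :=
  Fps (fun n => \sum_(i < n.+1) coefs f i * coefs g (n - i)).

Fact add_fpsA : associative add_fps.
Proof. by move=> f g h; apply/fpsP => n /=; rewrite addrA. Qed.
Fact add_fpsC : commutative add_fps.
Proof. by move=> f g; apply/fpsP => n /=; rewrite addrC. Qed.
Fact add0_fps : left_id (fpsC 0) add_fps.
Proof. by move=> f; apply/fpsP => n /=; case: ifP; rewrite add0r. Qed.
Fact addN_fps : left_inverse (fpsC 0) opp_fps add_fps.
Proof. by move=> f; apply/fpsP => n /=; case: ifP; rewrite addNr. Qed.

HB.instance Definition _ :=
  GRing.isZmodule.Build (fps K) add_fpsA add_fpsC add0_fps addN_fps.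

Let tr n f : {poly K} := \poly_(i < n.+1) coefs f i.

Let tr_coef n f k : (k <= n)%N -> (tr n f)`_k = coefs f k.
Proof. by move=> kn; rewrite coef_poly ltnS kn. Qed.

Let tr_mul n f g k :
  (k <= n)%N -> (tr n f * tr n g)`_k = coefs (mul_fps f g) k.
Proof.
move=> kn; rewrite coefM; apply: eq_bigr => i _.
have ik : (i <= k)%N by rewrite -ltnS.
by rewrite !tr_coef ?(leq_trans _ kn) ?leq_subr.
Qed.

Fact mul_fpsC : commutative mul_fps.
Proof. by move=> f g; apply/fpsP => n; rewrite -!(tr_mul _ _ (leqnn n)) mulrC. Qed.

Fact mul_fpsA : associative mul_fps.
Proof.
move=> f g h; apply/fpsP => n.
transitivity ((tr n f * (tr n g * tr n h))`_n); last first.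
  rewrite mulrA coefM; apply: eq_bigr => i _.
  have ik : (i <= n)%N by rewrite -ltnS.
  by rewrite tr_mul ?tr_coef ?leq_subr.
rewrite coefM; apply: eq_bigr => i _.
have ik : (i <= n)%N by rewrite -ltnS.
by rewrite tr_mul ?tr_coef ?leq_subr.
Qed.

Fact mul1_fps : left_id (fpsC 1) mul_fps.
Proof.
move=> f; apply/fpsP => n /=; rewrite big_ord_recl /= mul1r subn0.
by rewrite big1 ?addr0 // => i _; rewrite mul0r.
Qed.

Fact mul_fpsDl : left_distributive mul_fps add_fps.
Proof.
move=> f g h; apply/fpsP => n /=; rewrite -big_split /=.
by apply: eq_bigr => i _; rewrite mulrDl.
Qed.

Fact fps1_neq0 : fpsC 1 != 0.
Proof.
by apply/eqP => /fpsP/(_ 0%N) /= /eqP; rewrite oner_eq0.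
Qed.

HB.instance Definition _ := GRing.Zmodule_isComNzRing.Build (fps K)
  mul_fpsA mul_fpsC mul1_fps mul_fpsDl fps1_neq0.

Lemma coefs0 n : coefs (0 : fps K) n = 0. Proof. by case: n. Qed.
Lemma coefs1 n : coefs (1 : fps K) n = (n == 0%N)%:R. Proof. by case: n. Qed.
Lemma coefsD f g n : coefs (f + g) n = coefs f n + coefs g n. Proof. by []. Qed.
Lemma coefsN f n : coefs (- f) n = - coefs f n. Proof. by []. Qed.
Lemma coefsM f g n :
  coefs (f * g) n = \sum_(i < n.+1) coefs f i * coefs g (n - i).
Proof. by []. Qed.
Lemma coefs0M f g : coefs (f * g) 0 = coefs f 0 * coefs g 0.
Proof. by rewrite coefsM big_ord1. Qed.

(* The series whose n-th coefficient is computed by [next] from the list of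
   the coefficients of index < n. *)
Definition fps_rec (next : seq K -> K) : fps K :=
  Fps (fun n => next (iter n (fun s => rcons s (next s)) [::])).

Lemma coefs_fps_rec next n :
  coefs (fps_rec next) n = next (mkseq (coefs (fps_rec next)) n).
Proof.
rewrite /=; congr next; elim: n => // n IHn.
by rewrite mkseqS -IHn.
Qed.

Definition unit_fps : pred (fps K) := fun f => coefs f 0 != 0.

Definition inv_next f (s : seq K) : K :=
  ((size s == 0%N)%:R - \sum_(i < size s) s`_i * coefs f (size s - i))
    / coefs f 0.

Definition inv_fps f : fps K :=
  if unit_fps f then fps_rec (inv_next f) else f.

Fact mulV_fps : {in unit_fps, left_inverse 1 inv_fps *%R}.
Proof.
move=> f uf; have f0 : coefs f 0 != 0 by [].
rewrite /inv_fps; have -> : unit_fps f = true by exact: f0.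
move: (fps_rec _) (coefs_fps_rec (inv_next f)) => r rE.
apply/fpsP => n; rewrite coefsM coefs1 big_ord_recr /= subnn.
rewrite (rE n) /inv_next size_mkseq divfK //.
set S := \sum_(i < n) _; set T := \sum_(i < n) _.
have -> : S = T by apply: eq_bigr => i _; rewrite nth_mkseq.
by rewrite addrC subrK.
Qed.

Fact unit_fpsPl f g : g * f = 1 -> unit_fps f.
Proof.
move=> /fpsP/(_ 0%N); rewrite coefs0M coefs1 eqxx => e.
by apply/eqP => f0; move/eqP: e; rewrite f0 mulr0 eq_sym oner_eq0.
Qed.

Fact inv_fps_out : {in [predC unit_fps], inv_fps =1 id}.
Proof. by move=> f /negP nf; rewrite /inv_fps; case: ifP. Qed.

HB.instance Definition _ := GRing.ComNzRing_hasMulInverse.Build (fps K)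
  mulV_fps unit_fpsPl inv_fps_out.

Lemma unit_fpsE f : (f \is a GRing.unit) = (coefs f 0 != 0).
Proof. by []. Qed.

Let low f : f != 0 ->
  exists2 n, coefs f n != 0 & forall i, (i < n)%N -> coefs f i = 0.
Proof.
move=> nz; have ex : exists n, coefs f n != 0.
  apply: boolp.contrapT => nex; case/negP: nz; apply/eqP/fpsP => n.
  rewrite coefs0; apply/eqP; apply: boolp.contrapT => /negP h.
  by apply: nex; exists n.
case: (ex_minnP ex) => n fn mn; exists n => // i; rewrite ltnNge => h.
by apply/eqP; apply: contraNT h => /mn.
Qed.

Fact fps_idomain : GRing.integral_domain_axiom (fps K).
Proof.
move=> f g fg0; apply/norP => -[/low[m fm lf] /low[n gn lg]].
have /fpsP/(_ (m + n)%N) := fg0; rewrite coefs0 coefsM.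
have mlt : (m < (m + n).+1)%N by rewrite ltnS leq_addr.
rewrite (bigD1 (Ordinal mlt)) //= addKn big1 ?addr0.
  by move/eqP; rewrite mulf_eq0 (negbTE fm) (negbTE gn).
move=> i neq; have [lt|ge] := ltnP i m; first by rewrite lf ?mul0r.
have lt : (m < i)%N.
  rewrite ltn_neqAle ge andbT; apply: contraNneq neq => e.
  by apply/eqP/val_inj.
rewrite lg ?mulr0 // ltn_subLR ?ltn_add2r //.
by rewrite -ltnS.
Qed.

HB.instance Definition _ :=
  GRing.ComUnitRing_isIntegral.Build (fps K) fps_idomain.

(* The square root with constant term 1, obtained by solving s ^+ 2 = f
   coefficient by coefficient; it is meaningful when 2 != 0 in K and f has
   constant term 1, see [fps_sqrtP] and [fps_sqrt_uniq]. *)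
Definition sqrt_next f (s : seq K) : K :=
  if size s == 0%N then 1
  else (coefs f (size s) - \sum_(1 <= i < size s) s`_i * s`_(size s - i)) / 2.

Definition fps_sqrt f : fps K := fps_rec (sqrt_next f).

Lemma coefs_sqrt0 f : coefs (fps_sqrt f) 0 = 1.
Proof. by []. Qed.

Lemma fps_sqrtP f : (2 : K) != 0 -> coefs f 0 = 1 -> fps_sqrt f ^+ 2 = f.
Proof.
move=> two f0; apply/fpsP => -[|n]; rewrite expr2.
  by rewrite coefs0M coefs_sqrt0 f0 mulr1.
have s0 := coefs_sqrt0 f; rewrite /fps_sqrt in s0 *.
move: (fps_rec _) (coefs_fps_rec (sqrt_next f)) s0 => r rE r0.
rewrite coefsM big_ord_recr big_ord_recl /= subn0 subnn r0 mulr1 mul1r.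
rewrite addrAC -mulr2n -mulr_natr (rE n.+1) /sqrt_next size_mkseq divfK //.
rewrite big_add1 big_mkord; set S := \sum_(i < n) _; set T := \sum_(i < n) _.
have -> : S = T; last by rewrite subrK.
apply: eq_bigr => i _.
have ni : (n - i < n.+1)%N by rewrite ltnS leq_subr.
have lin : (i.+1 < n.+1)%N by rewrite ltnS.
by rewrite !subSS !nth_mkseq.
Qed.

Lemma fps_sqrt_uniq f g : (2 : K) != 0 ->
  g ^+ 2 = f -> coefs g 0 = 1 -> g = fps_sqrt f.
Proof.
move=> two gf g0; have f0 : coefs f 0 = 1.
  by rewrite -gf expr2 coefs0M g0 mulr1.
have /eqP : g ^+ 2 = fps_sqrt f ^+ 2 by rewrite fps_sqrtP.
rewrite eqf_sqr => /orP[/eqP //|/eqP/fpsP/(_ 0%N)].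
rewrite g0 coefsN coefs_sqrt0 => /eqP.
by rewrite -subr_eq0 opprK -mulr2n (negbTE two).
Qed.

End FpsRing.

Arguments fpsX {K}.

Inductive step := Up | Down | Horiz.

Definition step_code s : 'I_3 :=
  match s with Up => inord 0 | Down => inord 1 | Horiz => inord 2 end.
Definition step_decode (i : 'I_3) : step :=
  match val i with 0 => Up | 1 => Down | _ => Horiz end.
Fact step_codeK : cancel step_code step_decode.
Proof. by case; rewrite /step_decode /= inordK. Qed.

HB.instance Definition _ := Countable.copy step (can_type step_codeK).
HB.instance Definition _ : isFinite step := CanIsFinite step_codeK.

Definition step_vec (s : step) : int * int :=
  match s with Up => (1, 1) | Down => (1, -1) | Horiz => (2, 0) end.

Definition vertex (P : seq step) (i : nat) : int * int :=
  \sum_(s <- take i P) step_vec s.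

Definition schroeder (n : nat) (P : seq step) : bool :=
  (vertex P (size P) == (n.*2%:Z, 0)) &&
  [forall i : 'I_(size P).+1, 0 <= (vertex P i).2].

(* zip truncates to the shorter list: these are the size P - 1 pairs of
   consecutive steps, i.e. the inner vertices of P. *)
Definition consecutive (P : seq step) : seq (step * step) := zip P (behead P).

Definition dr (P : seq step) : nat :=
  (count_mem (Up, Up) (consecutive P) + count_mem (Down, Down) (consecutive P))%N.

Definition hr (P : seq step) : nat := count_mem (Horiz, Horiz) (consecutive P).

(* Hence the finite type n.*2.-bseq step contains all the paths of order n. *)
Lemma schroeder_size n P : schroeder n P -> (size P <= n.*2)%N.
Proof.
case/andP => /eqP e _; suff: (size P)%:Z <= n.*2%:Z by [].
have -> : n.*2%:Z = (vertex P (size P)).1 by rewrite e.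
rewrite /vertex take_size; elim: P {e} => [|s P IHP]; first by rewrite big_nil.
rewrite big_cons /= -addn1 PoszD addrC lerD //.
by case: s.
Qed.

Notation "x %:F" := (FracField.tofrac x) : ring_scope.

(* Q(y, z) as the fraction field of Q[y][z]: y is the inner variable. *)
Definition Qyz : fieldType := {fraction {poly {poly rat}}}.
Definition vy : Qyz := ('X%:P)%:F.
Definition vz : Qyz := ('X)%:F.

(* The coefficient of x ^ n is the sum over the paths of order n; schroeder 0
   only holds of the empty path, which is not in the sum (n >= 1). *)
Definition schroeder_runs : fps Qyz :=
  1 + Fps (fun n => if n == 0%N then 0 else
        \sum_(P : n.*2.-bseq step | schroeder n P) vy ^+ dr P * vz ^+ hr P).

(* Main.v *)
(* Let a = 1 + x/(1 - xz) and b = y + x/(1 - xz) be the series of the possibly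
   empty horizontal segments inserted at a peak or valley (or at an end), resp.
   between two equal diagonal steps, of the Dyck path obtained from a Schroeder
   path by deleting its horizontal steps; then u = x b^2 and w = (a / b)^2.  Let
   F be the Narayana series F = 1 + u F (F - 1 + w).  Rather than decomposing
   paths, consider the series E p h of the suffixes that start at height h just
   after a step p.  Splitting off the first step gives a linear system that
   determines them, and with I = a / (1 - x b^2 F) it is solved by
   E Down h = (b F)^h a F and E Up (h + 1) = I (b F)^h a F.  At h = 0 this is
   the series a F of all paths. *)

Require Import Defs.
From HB Require Import structures.
From mathcomp Require Import all_boot all_order all_algebra.
From mathcomp Require Import zify ring.

Set Implicit Arguments.
Unset Strict Implicit.
Unset Printing Implicit Defensive.

Import Order.TTheory GRing.Theory Num.Theory.
Local Open Scope ring_scope.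

(** * Recursive description of path suffixes *)

Fixpoint suffix_path (h k : nat) (P : seq step) : bool :=
  match P with
  | [::] => (h == 0%N) && (k == 0%N)
  | Up :: Q => if k is k'.+1 then suffix_path h.+1 k' Q else false
  | Down :: Q => if h is h'.+1 then suffix_path h' k Q else false
  | Horiz :: Q => if k is k'.+1 then suffix_path h k' Q else false
  end.

Lemma vertex_cons s P i : vertex (s :: P) i.+1 = step_vec s + vertex P i.
Proof. by rewrite /vertex /= big_cons. Qed.

Lemma vertex0 P : vertex P 0 = 0.
Proof. by rewrite /vertex take0 big_nil. Qed.

(** The coordinate sum grows by 2 at [Up] and [Horiz] and by 0 at [Down]. This rules out [k = 0] for
    a suffix starting with [Up] or [Horiz]. *)
Lemma vertex_sum_ge0 P : 0 <= (vertex P (size P)).1 + (vertex P (size P)).2.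
Proof.
elim: P => [|s P IHP]; first by rewrite vertex0.
by rewrite [size _]/= vertex_cons; case: s => /=; lia.
Qed.

(** [k] counts the [Up] and [Horiz] steps. Descending from height [h] to the axis takes [h] more
    [Down] than [Up] steps, so the width is [2k + h]; for [h = 0], [k] is the order. *)
Lemma suffix_pathP h k P :
  suffix_path h k P <->
  [/\ (vertex P (size P)).1 = (k.*2 + h)%N%:Z,
      (vertex P (size P)).2 = - h%:Z
    & forall i, (i <= size P)%N -> 0 <= h%:Z + (vertex P i).2].
Proof.
elim: P h k => [|s P IHP] h k.
  rewrite /= vertex0 /=; split=> [/andP[/eqP-> /eqP->]|[h1 h2 _]].
    by split=> // i; rewrite leqn0 => /eqP->; rewrite vertex0.
  by apply/andP; split; apply/eqP; lia.
rewrite [size _]/= vertex_cons; have endP := vertex_sum_ge0 P.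
have step_iff h' k' :
    h'%:Z = h%:Z + (step_vec s).2 ->
    (k'.*2 + h')%N%:Z + (step_vec s).1 = (k.*2 + h)%N%:Z ->
    suffix_path h' k' P <->
    [/\ (step_vec s + vertex P (size P)).1 = (k.*2 + h)%N%:Z,
        (step_vec s + vertex P (size P)).2 = - h%:Z
      & forall i, (i <= (size P).+1)%N -> 0 <= h%:Z + (vertex (s :: P) i).2].
  move=> hE kE; rewrite IHP /=; split=> -[e1 e2 H]; split; try lia.
  - move=> [|i] iP; first by rewrite vertex0 addr0.
    by have := H i iP; rewrite vertex_cons hE -addrA.
  - by move=> i iP; have := H i.+1 iP; rewrite vertex_cons /= addrA -hE.
case: s step_iff => step_iff /=.
- by case: k step_iff => [|k] step_iff; [split=> // -[/= *]|apply: step_iff => /=]; lia.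
- case: h step_iff => [|h] step_iff; last by apply: step_iff => /=; lia.
  by split=> // -[_ _ /(_ 1%N isT)]; rewrite vertex_cons vertex0.
- by case: k step_iff => [|k] step_iff; [split=> // -[/= *]|apply: step_iff => /=]; lia.
Qed.

Lemma schroeder_suffix_path n P : schroeder n P = suffix_path 0 n P.
Proof.
apply/andP/idP => [[/eqP vE /forallP nonneg]|/suffix_pathP[e1 e2 nonneg]].
  apply/suffix_pathP; rewrite vE /= addn0; split=> // i iP.
  by have := nonneg (Ordinal (iP : (i < (size P).+1)%N)); rewrite add0r.
split; last by apply/forallP => -[i iP]; have := nonneg i iP; rewrite add0r.
by apply/eqP; move: e1 e2; rewrite addn0; case: (vertex P _) => a b /= -> ->.
Qed.

(* The equality test of [step] does not compute: it goes through [inord]. *)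
Lemma step_eqE (s t : step) :
  (s == t) = match s, t with
             | Up, Up | Down, Down | Horiz, Horiz => true
             | _, _ => false
             end.
Proof. by case: s; case: t; apply/eqP. Qed.

(** * Sums over words of bounded length *)

Fixpoint words (N : nat) : seq (seq step) :=
  if N is N'.+1 then
    [::] :: [seq s :: P | s <- [:: Up; Down; Horiz], P <- words N']
  else [:: [::]].

Lemma wordsS N :
  words N.+1 =
    [::] :: [seq s :: P | s <- [:: Up; Down; Horiz], P <- words N].
Proof. by []. Qed.

Lemma mem_words N P : (P \in words N) = (size P <= N)%N.
Proof.
elim: N P => [|N IHN] [|s P] //.
rewrite wordsS in_cons orFb [size _]/=.
apply/idP/idP => [/allpairsP[[t Q] [_ /= QN [_ ->]]]|PN]; first by rewrite ltnS -IHN.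
apply/allpairsPdep; exists s, P; rewrite IHN; split=> //.
by rewrite !inE !step_eqE; case: s {PN}.
Qed.

Lemma words_uniq N : uniq (words N).
Proof.
elim: N => // N IHN; rewrite wordsS cons_uniq; apply/andP; split.
  by apply/allpairsP => -[[t Q] []].
apply: allpairs_uniq => //; first by rewrite /= !inE !step_eqE.
by move=> [s P] [t Q] _ _ [-> ->].
Qed.

(** The enumeration by [words] lets a sum be split according to the first step. *)
Lemma big_bseq_words (V : nmodType) N (ok : pred (seq step)) (F : seq step -> V) :
  \sum_(P : N.-bseq step | ok P) F P = \sum_(P <- words N | ok P) F P.
Proof.
rewrite -(big_map (fun P : N.-bseq step => P : seq step) ok F).
apply: perm_big; apply: uniq_perm; last 1 first.
- move=> P; rewrite mem_words; apply/mapP/idP => [[Q _ ->]|PN].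
    exact: size_bseq.
  by exists (Bseq PN); rewrite ?mem_index_enum.
- by rewrite map_inj_uniq ?index_enum_uniq //; exact: val_inj.
exact: words_uniq.
Qed.

(** * Run weights and the linear system *)

Section Runs.
Variables (K : fieldType) (y z : K).

Definition run_weight (s t : step) : K :=
  match s, t with
  | Up, Up | Down, Down => y
  | Horiz, Horiz => z
  | _, _ => 1
  end.

Fixpoint weight_after (s : step) (P : seq step) : K :=
  if P is t :: Q then run_weight s t * weight_after t Q else 1.

Lemma weight_after_cons s P :
  weight_after s P = y ^+ dr (s :: P) * z ^+ hr (s :: P).
Proof.
elim: P s => [|t P IHP] s; first by rewrite /= mulr1.
rewrite /= IHP /dr /hr [consecutive [:: s, t & P]]/= /=.
rewrite !xpair_eqE !step_eqE.
case: s; case: t;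
  rewrite /= ?mul1r ?add0n ?add1n ?addSn ?addnS ?exprS ?mulrA //.
by rewrite [z * _]mulrC mulrAC.
Qed.

(** No suffix at height 0 starts with [Down], so a fictitious preceding [Down] creates no run. *)
Lemma weight_after_Down k P :
  suffix_path 0 k P -> weight_after Down P = y ^+ dr P * z ^+ hr P.
Proof.
case: P => [|s P]; first by rewrite /= mulr1.
by rewrite -weight_after_cons; case: s => //= _; rewrite mul1r.
Qed.

(* Here x marks the up and horizontal steps, so
   that a path from height h with k of them has at most 2k + h steps. *)
Definition suffix_system (E : step -> nat -> fps K) : Prop :=
  forall p h,
    E p h = (if h is h'.+1 then fpsC (run_weight p Down) * E Down h' else 1)
      + fpsX * (fpsC (run_weight p Up) * E Up h.+1
                + fpsC (run_weight p Horiz) * E Horiz h).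

Lemma coefs_fpsCM c (f : fps K) n : coefs (fpsC c * f) n = c * coefs f n.
Proof.
rewrite coefsM big_ord_recl /= subn0 big1 ?addr0 // => i _.
by rewrite mul0r.
Qed.

Lemma coefs_fpsXM0 (f : fps K) : coefs (fpsX * f) 0 = 0.
Proof. by rewrite coefs0M mul0r. Qed.

Lemma coefs_fpsXMS (f : fps K) n : coefs (fpsX * f) n.+1 = coefs f n.
Proof.
rewrite coefsM !big_ord_recl /= mul0r mul1r add0r subSS subn0 big1 ?addr0 // => i _.
by rewrite mul0r.
Qed.

(** Every step lowers [2k + h] by at least 1, so induction on [N] applies after the first step is
    removed. In particular the system has at most one solution. *)
Lemma suffix_system_coefs E N p h k : suffix_system E -> (k.*2 + h <= N)%N ->
  \sum_(P <- words N | suffix_path h k P) weight_after p P = coefs (E p h) k.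
Proof.
move=> sysE; elim: N p h k => [|N IHN] p h k hkN.
  have [-> ->] : h = 0%N /\ k = 0%N by lia.
  by rewrite /= big_cons big_nil /= addr0 sysE coefsD coefs_fpsXM0 coefs1 addr0.
rewrite [words _]/= big_cons !big_cat big_nil !big_map /= addr0 sysE.
have step_sum s h' k' : (k'.*2 + h' <= N)%N ->
    \sum_(P <- words N | suffix_path h' k' P) run_weight p s * weight_after s P
    = run_weight p s * coefs (E s h') k'.
  by move=> hk; rewrite -mulr_sumr IHN.
case: h hkN => [|h] hkN; case: k hkN => [|k] hkN;
  rewrite coefsD ?coefs_fpsXM0 ?coefs_fpsXMS ?coefsD ?coefs_fpsCM ?coefs1 /=
    ?big_pred0_eq ?step_sum ?add0r ?addr0 //;
  try lia.
by rewrite addrCA.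
Qed.

Section Solution.
Variables e F : fps K.
Let x : fps K := fpsX.
Let Y := fpsC y.
Let Z := fpsC z.
Let a := 1 + e.
Let b := Y + e.
Hypothesis eE : e * (1 - x * Z) = x.
Hypothesis FE : F = 1 + x * b ^+ 2 * F * (F - 1) + x * a ^+ 2 * F.

Lemma suffix_system_solution :
  exists2 E, suffix_system E & E Down 0%N = a * F.
Proof.
have x0 f : coefs (1 - x * f) 0 = 1 by rewrite coefsD coefsN coefs_fpsXM0 subr0.
have uc : 1 - x * Z \is a GRing.unit by rewrite unit_fpsE x0 oner_eq0.
have ud : 1 - x * (b ^+ 2 * F) \is a GRing.unit by rewrite unit_fpsE x0 oner_eq0.
pose I := a / (1 - x * (b ^+ 2 * F)).
have IE : I * (1 - x * (b ^+ 2 * F)) = a by rewrite divrK.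
(* Multiplied by the denominator of [I], this becomes [FE]. *)
have FI : 1 + x * a * I * F = F.
  apply: (mulIr ud).
  transitivity (1 - x * (b ^+ 2 * F) + x * a * F * (I * (1 - x * (b ^+ 2 * F)))).
    by ring.
  rewrite IE.
  transitivity (1 + x * b ^+ 2 * F * (F - 1) + x * a ^+ 2 * F - x * b ^+ 2 * F * F).
    by ring.
  by rewrite -FE; ring.
pose M h := (b * F) ^+ h * (a * F).
pose V h := I * M h.
pose pre (p : step) h := if h is h'.+1 then fpsC (run_weight p Down) * M h' else 1.
(* In the equation for [p = Horiz] the unknown also occurs on the right, with factor [x * Z];
   solving for it gives [EH]. *)
pose EH h := (pre Horiz h + x * V h) / (1 - x * Z).
have EHE h : EH h * (1 - x * Z) = pre Horiz h + x * V h by rewrite divrK.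
have xEH h : x * EH h = e * (pre Horiz h + x * V h).
  by rewrite -EHE -{1}eE; ring.
(* [E] is the right-hand side of the system with the expected values inserted; it remains to check
   that it takes these values. [E Up 0] never occurs on the right. *)
pose E p h :=
  pre p h + x * (fpsC (run_weight p Up) * V h + fpsC (run_weight p Horiz) * EH h).
have one : fpsC (1 : K) = 1 by [].
have EDown h : E Down h = M h.
  rewrite /E /= one !mul1r mulrDr xEH.
  case: h => [|h]; rewrite /pre /V /M /= ?one ?exprS ?expr0 -/Y.
    transitivity (a * (1 + x * a * I * F)); first by rewrite /a; ring.
    by rewrite FI mul1r.
  transitivity ((b * F) ^+ h * (a * F) * (b * (1 + x * a * I * F))).
    by rewrite /a /b; ring.
  by rewrite FI; ring.
have EUp h : E Up h.+1 = V h.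
  rewrite /E /= one !mul1r mulrDr xEH /pre /V /M /= one mul1r -/Y exprS.
  transitivity ((b * F) ^+ h * (a * F) * (a + x * b ^+ 2 * F * I)).
    by rewrite /a /b; ring.
  by rewrite -IE; ring.
have EHoriz h : E Horiz h = EH h.
  rewrite /E /= one mul1r -/Z mulrDr addrA -EHE; ring.
exists E; last by rewrite EDown /M expr0 mul1r.
by move=> p h; rewrite EUp EHoriz {1}/E; case: h => [|h] //=; rewrite EDown.
Qed.

End Solution.
End Runs.

(** * Narayana series and closed form *)

Lemma fpsX_neq0 (K : fieldType) : (fpsX : fps K) != 0.
Proof. by apply/eqP => /fpsP/(_ 1%N)/eqP; rewrite coefs0 /= oner_eq0. Qed.

Lemma fps2_unit (K : fieldType) : (2 : K) != 0 -> (2 : fps K) \is a GRing.unit.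
Proof. by rewrite unit_fpsE coefsD coefs1. Qed.

Lemma fps_unit_neq0 (K : fieldType) (f : fps K) : f \is a GRing.unit -> f != 0.
Proof. by apply: contraTneq => ->; rewrite unitr0. Qed.

(* The numerator vanishes at x = 0, so that the quotient is a power series
   although its denominator 2 u is not a unit. *)
Lemma narayana_series (K : fieldType) (b w : fps K) (u := fpsX * b ^+ 2)
    (s := fps_sqrt (1 - 2 * (1 + w) * u + (1 - w) ^+ 2 * u ^+ 2)) :
    (2 : K) != 0 -> b \is a GRing.unit ->
  exists2 F, 2 * u * F = 1 + (1 - w) * u - s & F = 1 + u * F * (F - 1) + u * w * F.
Proof.
move=> two ub.
have ub2 : 2 * b ^+ 2 \is a GRing.unit.
  by rewrite unitrM unitrX ?fps2_unit.
have ss : s ^+ 2 = 1 - 2 * (1 + w) * u + (1 - w) ^+ 2 * u ^+ 2.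
  apply: fps_sqrtP => //.
  have -> : 1 - 2 * (1 + w) * u + (1 - w) ^+ 2 * u ^+ 2
      = 1 + fpsX * ((- 2 * (1 + w) + (1 - w) ^+ 2 * u) * b ^+ 2).
    by rewrite /u; ring.
  by rewrite coefsD coefs_fpsXM0 coefs1 addr0.
pose p := 1 + (1 - w) * u - s.
have p0 : coefs p 0 = 0.
  rewrite coefsD coefsN coefs_sqrt0 coefsD coefs1 /u mulrCA coefs_fpsXM0.
  by rewrite addr0 subrr.
pose q := Fps (fun n => coefs p n.+1).
have pE : p = fpsX * q by apply/fpsP => -[|n]; rewrite ?coefs_fpsXM0 ?coefs_fpsXMS.
pose F := q / (2 * b ^+ 2).
have FE : 2 * u * F = p.
  by rewrite pE -[q in RHS](divrK ub2) -/F /u; ring.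
exists F => //.
(* Completing the square: [4 * u] times the equation for [F] is the identity [ss]. *)
have uF : 4 * u != 0.
  have -> : 4 * u = 2 * fpsX * (2 * b ^+ 2) by rewrite /u; ring.
  rewrite mulf_neq0 ?(fps_unit_neq0 ub2) //.
  by rewrite mulf_neq0 ?fpsX_neq0 ?fps_unit_neq0 ?fps2_unit.
apply: (mulfI uF); apply/eqP; rewrite -subr_eq0; apply/eqP.
have sE : s = 1 + (1 - w) * u - 2 * u * F by rewrite FE /p; ring.
move: ss; rewrite sE => /eqP; rewrite -subr_eq0 => /eqP ss.
by rewrite -[RHS]oppr0 -ss; ring.
Qed.

(** The constant term of [b] is [y], so [y != 0] makes [b] a unit and [w] a genuine quotient of
    series. Since [2 * u] has constant term 0, dividing by it takes place in the fraction field. *)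
Lemma suffix_system_closed_form (K : fieldType) (y z : K)
    (x := fpsX) (Y := fpsC y) (Z := fpsC z)
    (u := x * ((x + Y * (1 - x * Z)) / (1 - x * Z)) ^+ 2)
    (w := ((1 - x * Z + x) / (x + Y * (1 - x * Z))) ^+ 2) :
    y != 0 -> (2 : K) != 0 ->
  exists2 E, suffix_system y z E &
    (E Down 0%N)%:F =
    ((1 - x * Z + x) / (1 - x * Z))%:F *
    ((1 + (1 - w) * u
        - fps_sqrt (1 - 2 * (1 + w) * u + (1 - w) ^+ 2 * u ^+ 2))%:F
     / (2 * u)%:F)
  :> {fraction (fps K)}.
Proof.
move=> y0 two; pose c := 1 - x * Z; pose e := x / c.
have uc : c \is a GRing.unit.
  by rewrite unit_fpsE coefsD coefsN coefs_fpsXM0 subr0 coefs1 oner_eq0.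
have bE : (x + Y * c) / c = Y + e by rewrite mulrDl mulrK // addrC.
have aE : (c + x) / c = 1 + e by rewrite mulrDl divrr.
have ub : Y + e \is a GRing.unit.
  by rewrite unit_fpsE coefsD coefs_fpsXM0 addr0.
have uE : u = fpsX * (Y + e) ^+ 2 by rewrite /u bE.
(* The factor [b ^+ 2] cancels, which turns the Narayana equation into the one for [a] and [b]. *)
have uwE : u * w = x * (1 + e) ^+ 2.
  have ubc : x + Y * c \is a GRing.unit.
    by rewrite -(divrK uc (x + _)) bE unitrM ub.
  have split_a : (c + x) / c = (c + x) / (x + Y * c) * ((x + Y * c) / c).
    by rewrite mulrA divrK.
  by rewrite /u /w -/c -aE split_a [in RHS]exprMn [LHS]mulrAC [RHS]mulrA.
have [F] := narayana_series w two ub.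
rewrite -uE uwE => FE Frec.
have u2 : 2 * u != 0.
  have b0 := fps_unit_neq0 ub.
  by rewrite uE !mulf_neq0 ?fpsX_neq0 ?fps_unit_neq0 ?fps2_unit.
have [||E sysE E0] := @suffix_system_solution K y z e F.
- exact: divrK.
- by rewrite -/x -uE.
exists E => //; rewrite E0 -FE -/c aE -/Y rmorphM; congr (_ * _).
by rewrite rmorphM mulrAC divff ?mul1r ?tofrac_eq0.
Qed.

Theorem theorem2p1 :
  let x : fps Qyz := fpsX in
  let y : fps Qyz := fpsC vy in
  let z : fps Qyz := fpsC vz in
  let u := x * ((x + y * (1 - x * z)) / (1 - x * z)) ^+ 2 in
  let w := ((1 - x * z + x) / (x + y * (1 - x * z))) ^+ 2 in
  schroeder_runs%:F =
    ((1 - x * z + x) / (1 - x * z))%:F *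
    ((1 + (1 - w) * u
        - fps_sqrt (1 - 2 * (1 + w) * u + (1 - w) ^+ 2 * u ^+ 2))%:F
     / (2 * u)%:F)
  :> {fraction (fps Qyz)}.
Proof.
move=> x y z u w.
have vy0 : vy != 0 by rewrite tofrac_eq0 polyC_eq0 polyX_eq0.
have two : (2 : Qyz) != 0.
  rewrite -(rmorph_nat (@FracField.tofrac _)) tofrac_eq0.
  by rewrite -(rmorph_nat (@polyC _)) polyC_eq0 -(rmorph_nat (@polyC _)) polyC_eq0.
have [E sysE <-] := suffix_system_closed_form vz vy0 two.
congr (_%:F); apply/fpsP => n.
rewrite -(suffix_system_coefs Down sysE (leqnn _)) addn0 -big_bseq_words.
transitivity (\sum_(P : n.*2.-bseq step | schroeder n P) vy ^+ dr P * vz ^+ hr P).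
  (* For [n = 0] the summand 1 of the series is the weight of the empty path. *)
  rewrite /schroeder_runs coefsD coefs1 /=; case: n => [|n]; last by rewrite add0r.
  rewrite (eq_bigl (pred1 [bseq])) => [|P]; last first.
    by rewrite schroeder_suffix_path bseq0; apply/esym/eqP.
  by rewrite big_pred1_eq /= mulr1 addr0.
apply: eq_big => P; first exact: schroeder_suffix_path.
by rewrite schroeder_suffix_path => /weight_after_Down ->.
Qed.
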